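(* Let $d,d'\ge 1$ be integers and let $K\ge 1$ be a real number. Then there exists $N\in\mathbb{N}$, depending only on $d,d',K$, such that for every $d$-dimensional generalized geometric progression $G\subset\mathbb{R}$ and every $d'$-dimensional generalized geometric progression $H\subset\mathbb{R}$ with $|G|\ge N$, $|H|\ge N$ and $K^{-1}|H|\le|G|\le K|H|$, one has $$H+1\not\subset G.$$
   Context: For a finite set $H\subset\mathbb{R}$, $|H|$ denotes its number of elements and $H+1=\{h+1: h\in H\}$. Given real numbers $r_0,r_1,\dots,r_d$ (generators) and integers $l_1,\dots,l_d>2$, the $d$-dimensional generalized arithmetic progression they define is $$R=R(r_0,\dots,r_d,l_1,\dots,l_d)=\{r_0+x_1r_1+\dots+x_dr_d : x_j\in\mathbb{Z},\ 0\le x_j<l_j,\ j=1,\dots,d\}.$$ A $d$-dimensional generalized geometric progression is a set of the form $G=G(g_0,R)=\{g_0^{r}: r\in R\}$, where $g_0$ is a positive real number and $R$ is a $d$-dimensional generalized arithmetic progression. A progression is called non-degenerate if its dimension stays bounded (is like a constant) as the size of the progression grows; in the claim this is expressed by fixing the dimensions $d,d'$ first and letting $N$ depend on them. *)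

(* Defs.v *)
From HB Require Import structures.
From mathcomp Require Import all_boot all_order all_algebra finmap.
From mathcomp Require Import all_classical all_reals exp.

Set Implicit Arguments.
Unset Strict Implicit.
Unset Printing Implicit Defensive.

Import Order.TTheory GRing.Theory Num.Theory.

Local Open Scope classical_set_scope.
Local Open Scope ring_scope.

Definition gap (R : realType) (d : nat) (r0 : R) (r : 'I_d -> R)
    (l : 'I_d -> int) : set R :=
  [set y | exists2 x : 'I_d -> int,
    forall j, 0 <= x j < l j & y = r0 + \sum_(j < d) (x j)%:~R * r j].

(* The progressions need not be proper: the generators are arbitrary reals
   and different coefficient vectors may give the same element. *)
Definition is_gap (R : realType) (d : nat) (A : set R) : Prop :=
  exists (r0 : R) (r : 'I_d -> R) (l : 'I_d -> int),
    (forall j, 2 < l j) /\ A = gap r0 r l.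

Definition is_ggp (R : realType) (d : nat) (G : set R) : Prop :=
  exists (g0 : R) (A : set R),
    [/\ 0 < g0, is_gap d A & G = [set g0 `^ r | r in A]].

(* [fset_set] is the empty set on infinite sets, so [size_of] is the number of
   elements only on finite sets; [finite_ggp] shows that this is the case for
   all the progressions. *)
Definition size_of (R : realType) (A : set R) : nat := #|` fset_set A|%fset.

Lemma finite_gap (R : realType) (d : nat) (A : set R) :
  is_gap d A -> finite_set A.
Proof.
move=> [r0 [r [l [_ ->]]]].
pose m := (\max_(j < d) `|l j|)%N.
pose f (x : {ffun 'I_d -> 'I_m.+1}) : R :=
  r0 + \sum_(j < d) ((x j)%:Z)%:~R * r j.
apply: (@sub_finite_set _ _ (f @` setT)); last first.
  by apply: finite_image; exact: finite_finset.
move=> y [x xl ->]; exists [ffun j => inord `|x j|%N] => //.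
rewrite /f; congr (_ + _); apply: eq_bigr => j _; congr (_%:~R * _).
have /andP[x0 xlt] := xl j.
rewrite ffunE inordK ?gez0_abs// ltnS.
apply: leq_trans (leq_bigmax j).
by rewrite -lez_nat !gez0_abs ?(ltW xlt)// (le_trans x0 (ltW xlt)).
Qed.

Lemma finite_ggp (R : realType) (d : nat) (G : set R) :
  is_ggp d G -> finite_set G.
Proof.
by move=> [g0 [A [_ /finite_gap fA ->]]]; exact: finite_image.
Qed.

(* Main.v *)
Require Import Defs.
From HB Require Import structures.
From mathcomp Require Import all_boot all_order all_algebra finmap.
From mathcomp Require Import all_classical all_reals exp.
From mathcomp Require Import zify ring.

Set Implicit Arguments.
Unset Strict Implicit.
Unset Printing Implicit Defensive.

Import Order.TTheory GRing.Theory Num.Theory.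

Local Open Scope classical_set_scope.
Local Open Scope ring_scope.

(** Suppose that H + 1 is contained in G.  A generalized geometric progression
    has small doubling: in a product of two elements the exponents x + x' lie
    below 2 l, so the product set is covered by 2 ^ d dilates of the
    progression ([ggp_small_doubling]).  Hence A = H is a set of positive reals
    for which both A A, contained in H H, and (A + 1)(A + 1), contained in G G,
    have at most C |A| elements, with C depending on d, d' and K only.

    By an argument of Elekes such an A has bounded size
    ([size_shifted_products]).  For a, b in A the increasing line
    y = (b + 1)(x / a + 1) contains the |A| points (a c, (b + 1)(c + 1)), c in
    A, of the grid X * Y, where X contains A A and Y contains (A + 1)(A + 1).
    This gives |A|^2 lines with |A| points each on a grid of at most (C |A|)^2
    points, which the Szemeredi-Trotter theorem forbids for large A.  On a grid
    and for increasing lines, the following count is enough.  Along one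
    line the ranks of the coordinates in X and in Y increase by at most C |A|
    altogether, so for a positive proportion of the consecutive points
    c < c' both ranks grow by at most 8 C ([many_short_steps]).  Such a short
    step is given by the ranks of its starting point and two increments, hence
    by one of O((C |A|)^2 C^2) data; and it determines the line, because two
    points do ([ranks_determine_step]).  Thus |A|^3 = O(C^4 |A|^2). *)

(** * Ranks and gaps *)

Definition rank (F : realFieldType) (S : seq F) (x : F) : nat :=
  count (fun z => z < x) S.

Lemma rank_size (F : realFieldType) (S : seq F) (x : F) :
  (rank S x <= size S)%N.
Proof. exact: count_size. Qed.

Lemma rank_lt (F : realFieldType) (S : seq F) (x y : F) :
  x \in S -> x < y -> (rank S x < rank S y)%N.
Proof.
move=> xS xy; rewrite /rank (permP (perm_to_rem xS)) /= ltxx add0n.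
rewrite [X in (_ < X)%N](permP (perm_to_rem xS)) /= xy add1n ltnS.
by apply: sub_count => z /= zx; exact: lt_trans xy.
Qed.

Lemma rank_inj (F : realFieldType) (S : seq F) : {in S &, injective (rank S)}.
Proof.
move=> x y xS yS e; case: (ltgtP x y) => // /(rank_lt _) h.
- by have := h _ xS; rewrite e ltnn.
- by have := h _ yS; rewrite e ltnn.
Qed.

(** The gaps of a nondecreasing sequence add up to at most its last value, so
    only few of them can be large. *)
Lemma count_large_gaps (f : nat -> nat) (n s : nat) :
  (forall k, (k < n)%N -> (f k <= f k.+1)%N) ->
  (s * \sum_(k < n) (s < f k.+1 - f k) <= f n)%N.
Proof.
move=> fS; suff: (\sum_(k < n) (f k.+1 - f k) <= f n)%N.
  apply: leq_trans; rewrite big_distrr /=; apply: leq_sum => k _.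
  by case: ltnP => [/ltnW|_]; rewrite ?muln1 ?muln0.
elim: n fS => [_|n IHn fS]; first by rewrite big_ord0.
have := IHn (fun k kn => fS k (ltnW kn)); have := fS n (ltnSn n).
by rewrite big_ord_recr /=; lia.
Qed.

(** * Sets with few products and few shifted products *)

(** The points (a p, b (p + 1)) and (a q, b (q + 1)) lie on the line
    y = (b / a) x + b.  They determine its slope b / a and its intercept b,
    hence a, and then the parameter p. *)
Lemma line_of_two_points (F : realFieldType) (a b p q a' b' p' q' : F) :
  0 < a' -> 0 < p' -> p < q -> p' < q' -> 0 < b' ->
  a * p = a' * p' -> a * q = a' * q' ->
  b * (p + 1) = b' * (p' + 1) -> b * (q + 1) = b' * (q' + 1) ->
  [/\ a = a', b = b' & p = p'].
Proof.
move=> a'0 p'0 pq pq' b'0 eap eaq ebp ebq.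
have slope : b * a' = b' * a.
  have nz : (q - p) * (q' - p') != 0 by rewrite mulf_neq0 ?subr_eq0 ?gt_eqF.
  have ea : a * (q - p) = a' * (q' - p') by rewrite !mulrBr eap eaq.
  have eb : b * (q - p) = b' * (q' - p').
    transitivity (b * (q + 1) - b * (p + 1)); first by ring.
    by rewrite ebp ebq; ring.
  apply: (mulIf nz).
  transitivity ((b * (q - p)) * (a' * (q' - p'))); first by ring.
  by rewrite eb -ea; ring.
have bp : b * p = b' * p'.
  apply: (mulfI (lt0r_neq0 a'0)).
  transitivity ((b * a') * p); first by ring.
  by rewrite slope -mulrA eap; ring.
have bb' : b = b' by move: ebp; rewrite !mulrDr !mulr1 bp => /addrI.
have pp' : p = p' by apply: (mulfI (lt0r_neq0 b'0)); rewrite -bp bb'.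
by split=> //; apply: (mulIf (lt0r_neq0 p'0)); rewrite -eap pp'.
Qed.

Section ShiftedProducts.
Variables (F : realFieldType) (A X Y : seq F) (n C : nat).
Hypotheses (sA : sorted <%R A) (szA : size A = n.+1).
Hypothesis (A0 : {in A, forall a, 0 < a}).
Hypothesis (AX : {in A &, forall a b, a * b \in X}).
Hypothesis (AY : {in A &, forall a b, (a + 1) * (b + 1) \in Y}).
Hypothesis (szX : (size X <= C * n.+1)%N).
Hypothesis (szY : (size Y <= C * n.+1)%N).

Let a (k : nat) : F := nth 0 A k.
Let u (i k : nat) : nat := rank X (a i * a k).
Let v (j k : nat) : nat := rank Y ((a j + 1) * (a k + 1)).
(* The points of the line indexed by (i, j) are indexed by k; a step goes from
   the point k to the point k.+1. *)
Let short (i j k : nat) : bool :=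
  (u i k.+1 - u i k <= 8 * C)%N && (v j k.+1 - v j k <= 8 * C)%N.

Let aA k : (k < n.+1)%N -> a k \in A.
Proof. by move=> kn; rewrite mem_nth ?szA. Qed.

Let a0 k : (k < n.+1)%N -> 0 < a k.
Proof. by move=> kn; exact/A0/aA. Qed.

Let a_lt k : (k < n)%N -> a k < a k.+1.
Proof.
by move=> kn; rewrite /a (lt_sorted_ltn_nth 0 sA) ?inE ?szA// ltnS ltnW.
Qed.

Let a_inj i j : (i < n.+1)%N -> (j < n.+1)%N -> a i = a j -> i = j.
Proof.
move=> iln jln /eqP; rewrite /a nth_uniq ?szA// => [/eqP//|].
exact: lt_sorted_uniq.
Qed.

Let u_lt i k : (i < n.+1)%N -> (k < n)%N -> (u i k < u i k.+1)%N.
Proof.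
move=> iln kn; apply: rank_lt; first by rewrite AX ?aA// ltnW.
by rewrite ltr_pM2l ?a0 ?a_lt.
Qed.

Let v_lt j k : (j < n.+1)%N -> (k < n)%N -> (v j k < v j k.+1)%N.
Proof.
move=> jln kn; apply: rank_lt; first by rewrite AY ?aA// ltnW.
by rewrite ltr_pM2l ?ltrD2r ?a_lt// addr_gt0 ?a0.
Qed.

Let u_le i k : (u i k <= C * n.+1)%N.
Proof. exact: leq_trans (rank_size _ _) szX. Qed.

Let v_le j k : (v j k <= C * n.+1)%N.
Proof. exact: leq_trans (rank_size _ _) szY. Qed.

Let C_gt0 : (0 < C)%N.
Proof.
have := AX (aA (ltn0Sn n)) (aA (ltn0Sn n)).
by case: C szX => //; rewrite mul0n leqn0 size_eq0 => /eqP ->.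
Qed.

(** Since the ranks are at most C (n + 1), at most (n + 1) / 8 of the n steps
    have a rank increment above 8 C in X, and likewise in Y. *)
Lemma many_short_steps (i j : 'I_n.+1) : (0 < n)%N ->
  (n.+1 <= 4 * \sum_(k < n) short i j k)%N.
Proof.
move=> n0.
pose long_u := (\sum_(k < n) (8 * C < u i k.+1 - u i k))%N.
pose long_v := (\sum_(k < n) (8 * C < v j k.+1 - v j k))%N.
have hu : (8 * C * long_u <= C * n.+1)%N.
  apply: leq_trans (u_le i n); apply: count_large_gaps => k kn.
  exact/ltnW/u_lt.
have hv : (8 * C * long_v <= C * n.+1)%N.
  apply: leq_trans (v_le j n); apply: count_large_gaps => k kn.
  exact/ltnW/v_lt.
have cover : (n <= \sum_(k < n) short i j k + (long_u + long_v))%N.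
  rewrite -[X in (X <= _)%N]card_ord -sum1_card -!big_split /=.
  by apply: leq_sum => k _; rewrite /short !(ltnNge (8 * C));
    do 2![case: (_ - _ <= _)%N].
move: hu hv; rewrite ![(8 * C)%N]mulnC -!mulnA !leq_pmul2l//.
lia.
Qed.

(** A step of the line (i, j) is a pair of points of the grid, and these are
    recovered from the ranks of their coordinates. *)
Lemma ranks_determine_step :
  let T := ('I_n.+1 * 'I_n.+1 * 'I_n)%type in
  injective (fun t : T =>
    (u t.1.1 t.2, u t.1.1 t.2.+1, v t.1.2 t.2, v t.1.2 t.2.+1)).
Proof.
move=> T [[i j] k] [[i' j'] k'] /= [eu eu' ev ev'].
have kS (l : 'I_n) : (l < n.+1)%N by rewrite ltnW// ltnS.
have := @line_of_two_points F (a i) (a j + 1) (a k) (a k.+1)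
  (a i') (a j' + 1) (a k') (a k'.+1).
rewrite !a0 ?addr_gt0 ?a0 ?a_lt// => /(_ isT isT isT isT isT); case.
- by apply: rank_inj eu; rewrite AX ?aA.
- by apply: rank_inj eu'; rewrite AX ?aA// ltnS.
- by apply: rank_inj ev; rewrite AY ?aA.
- by apply: rank_inj ev'; rewrite AY ?aA// ltnS.
move=> /(a_inj (ltn_ord i) (ltn_ord i'))/ord_inj ->.
move=> /addIr/(a_inj (ltn_ord j) (ltn_ord j'))/ord_inj ->.
by move=> /(a_inj (kS k) (kS k'))/ord_inj ->.
Qed.

(** Short steps, indexed by the line (i, j) and the position k, are counted in
    two ways: below by [many_short_steps], and above by the number of possible
    ranks and increments, which determine the step. *)
Lemma size_shifted_products_sorted : (n.+1 <= 1296 * C ^ 4)%N.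
Proof.
have [n_eq0|n_gt0] := posnP n.
  by rewrite n_eq0 muln_gt0 expn_gt0 C_gt0.
pose T := ('I_n.+1 * 'I_n.+1 * 'I_n)%type.
pose M := (C * n.+1)%N; pose s := (8 * C)%N.
pose good := [pred t : T | short t.1.1 t.1.2 t.2].
have lower : (n.+1 * (n.+1 * n.+1) <= 4 * #|good|)%N.
  have -> : #|good| =
      (\sum_(i < n.+1) \sum_(j < n.+1) \sum_(k < n) short i j k)%N.
    by rewrite -sum1_card big_mkcond !pair_bigA.
  rewrite big_distrr /= -[X in (X * _)%N]card_ord -sum_nat_const.
  apply: leq_sum => i _; rewrite big_distrr /=.
  rewrite -[X in (X * _)%N]card_ord -sum_nat_const.
  by apply: leq_sum => j _; exact: many_short_steps.
have upper : (#|good| <= (M.+1 * s.+1) * (M.+1 * s.+1))%N.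
  pose f (t : T) : 'I_M.+1 * 'I_s.+1 * ('I_M.+1 * 'I_s.+1) :=
    ((inord (u t.1.1 t.2), inord (u t.1.1 t.2.+1 - u t.1.1 t.2)),
     (inord (v t.1.2 t.2), inord (v t.1.2 t.2.+1 - v t.1.2 t.2))).
  have finj : {in good &, injective f}.
    move=> t t' gt gt'; case: (andP gt) => su sv; case: (andP gt') => su' sv'.
    case=> /(congr1 val) /= eu /(congr1 val) /= edu
           /(congr1 val) /= ev /(congr1 val) /= edv.
    rewrite !inordK ?ltnS// in eu edu ev edv.
    apply: ranks_determine_step => /=.
    have := u_lt (ltn_ord t.1.1) (ltn_ord t.2).
    have := v_lt (ltn_ord t.1.2) (ltn_ord t.2).
    have := u_lt (ltn_ord t'.1.1) (ltn_ord t'.2).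
    have := v_lt (ltn_ord t'.1.2) (ltn_ord t'.2).
    by move=> *; congr (_, _, _, _) => //; lia.
  by have := @leq_card_in _ _ f good finj; rewrite !card_prod !card_ord.
have := leq_trans lower (leq_mul (leqnn 4) upper).
(* It remains to divide (n + 1)^3 <= 4 (2 C (n + 1))^2 (9 C)^2 by (n + 1)^2. *)
have M1 : (M.+1 <= 2 * C * n.+1)%N.
  by rewrite -mulnA -/M mul2n -addnn -addn1 leq_add2l muln_gt0 C_gt0.
have s1 : (s.+1 <= 9 * C)%N by rewrite /s; have := C_gt0; lia.
have := leq_mul (leq_mul M1 s1) (leq_mul M1 s1).
move=> h1 h2; have := leq_trans h2 (leq_mul (leqnn 4) h1).
have -> : (4 * (2 * C * n.+1 * (9 * C) * (2 * C * n.+1 * (9 * C))) =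
  1296 * C ^ 4 * (n.+1 * n.+1))%N by rewrite !expnS expn0; ring.
by rewrite leq_pmul2r.
Qed.
End ShiftedProducts.

(** In other words |A A| or |(A + 1)(A + 1)| is at least a constant times
    |A|^(5/4). *)
Lemma size_shifted_products (F : realFieldType) (A X Y : seq F) (C : nat) :
  uniq A -> {in A, forall a, 0 < a} ->
  {in A &, forall a b, a * b \in X} ->
  {in A &, forall a b, (a + 1) * (b + 1) \in Y} ->
  (size X <= C * size A)%N -> (size Y <= C * size A)%N ->
  (size A <= 1296 * C ^ 4)%N.
Proof.
move=> uA A0 AX AY; rewrite -(size_sort <=%R A).
have mS : sort <=%R A =i A by move=> x; rewrite mem_sort.
have : sorted <%R (sort <=%R A) by rewrite sort_lt_sorted.
case szA: (size (sort <=%R A)) => [//|n] sA szX szY.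
apply: (size_shifted_products_sorted sA szA) szX szY => [a|a b|a b];
  rewrite !mS.
- exact: A0.
- exact: AX.
- exact: AY.
Qed.

(** * Doubling of progressions *)

(** A coefficient x + x' that reaches the length l is reduced by l; the vector e
    records where this happens.  So 2 ^ d translates of the progression cover
    its sumset, even if the progression is not proper. *)
Lemma gap_add (R : realType) (d : nat) (r0 : R) (r : 'I_d -> R)
    (l : 'I_d -> int) (y z : R) : gap r0 r l y -> gap r0 r l z ->
  exists (e : {ffun 'I_d -> bool}) (w : R), gap r0 r l w /\
    y + z = (r0 + \sum_(j < d) (e j)%:R * ((l j)%:~R * r j)) + w.
Proof.
move=> [x xl ->] [x' x'l ->].
pose e : {ffun 'I_d -> bool} := [ffun j => l j <= x j + x' j].
pose w j := x j + x' j - (e j)%:R * l j.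
exists e, (r0 + \sum_(j < d) (w j)%:~R * r j); split.
  exists w => // j; rewrite /w ffunE; have := xl j; have := x'l j.
  by case: (leP (l j)) => /=; lia.
transitivity (r0 + r0 + \sum_(j < d) ((x j)%:~R * r j + (x' j)%:~R * r j)).
  by rewrite big_split /=; ring.
transitivity (r0 + r0 + \sum_(j < d)
    ((e j)%:R * ((l j)%:~R * r j) + (w j)%:~R * r j)).
  congr (_ + _); apply: eq_bigr => j _.
  by rewrite /w rmorphB rmorphD rmorphM /= rmorph_nat; ring.
by rewrite big_split /=; ring.
Qed.

Lemma ggp_gt0 (R : realType) (d : nat) (G : set R) (x : R) :
  is_ggp d G -> G x -> 0 < x.
Proof. by move=> [g0 [A [g0_gt0 _ ->]]] [r _ <-]; exact: powR_gt0. Qed.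

(** The bounding list consists of the 2 ^ d dilates of G provided by
    [gap_add]; it may contain repetitions, which only weakens the bound. *)
Lemma ggp_small_doubling (R : realType) (d : nat) (G : set R) :
  is_ggp d G -> exists2 X : seq R,
    size X = (2 ^ d * size_of G)%N & forall x y, G x -> G y -> x * y \in X.
Proof.
move=> gG; have fG := finite_ggp gG.
case: gG => g0 [A [g0_gt0 [r0 [r [l [_ eA]]]] eG]].
pose t (e : {ffun 'I_d -> bool}) : R :=
  g0 `^ (r0 + \sum_(j < d) (e j)%:R * ((l j)%:~R * r j)).
exists [seq t e * g | e <- enum {: {ffun 'I_d -> bool}}, g <- fset_set G].
  by rewrite size_allpairs -cardE card_ffun card_bool card_ord.
move=> x y; rewrite {1 2}eG => -[p + <-] [q + <-].
rewrite eA => /gap_add h /h [e [w [gw ew]]].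
have powD a b : g0 `^ (a + b) = g0 `^ a * g0 `^ b.
  by rewrite powRD// (gt_eqF g0_gt0) implybT.
rewrite -powD ew powD.
apply: allpairs_f; first by rewrite mem_enum.
by rewrite in_fset_set// inE eG; exists w; rewrite // eA.
Qed.

Theorem corollary1p4 (R : realType) (d d' : nat) (K : R) :
  (1 <= d)%N -> (1 <= d')%N -> 1 <= K ->
  exists N : nat, forall G H : set R,
    is_ggp d G -> is_ggp d' H ->
    (N <= size_of G)%N -> (N <= size_of H)%N ->
    K^-1 * (size_of H)%:R <= (size_of G)%:R <= K * (size_of H)%:R ->
    ~ ([set h + 1 | h in H] `<=` G).
Proof.
move=> _ _ K1; pose C := (2 ^ d' + 2 ^ d * Num.bound K)%N.
exists (1296 * C ^ 4).+1 => G H gG gH _ NH /andP[_ GH] HG.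
have [X szX HX] := ggp_small_doubling gH.
have [Y szY GY] := ggp_small_doubling gG.
have mH h : h \in (fset_set H : seq R) -> H h.
  by rewrite in_fset_set ?inE//; exact: finite_ggp gH.
have hG h : H h -> G (h + 1) by move=> Hh; apply: HG; exists h.
have GHn : (size_of G <= Num.bound K * size_of H)%N.
  rewrite -(ler_nat R) natrM; apply: le_trans GH _.
  by rewrite ler_wpM2r// ltW// archi_boundP// (le_trans ler01).
suff : (size_of H <= 1296 * C ^ 4)%N by rewrite leqNgt NH.
apply: (@size_shifted_products _ (fset_set H) X Y).
- exact: fset_uniq.
- by move=> h /mH; exact: ggp_gt0 gH.
- by move=> a b /mH Ha /mH Hb; exact: HX.
- by move=> a b /mH Ha /mH Hb; apply: GY; exact: hG.
- by rewrite szX leq_mul2r leq_addr orbT.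
- rewrite szY; apply: leq_trans (leq_mul (leqnn _) GHn) _.
  by rewrite mulnA leq_mul2r leq_addl orbT.
Qed.
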